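(* Let $M$ be a metrizable topological space, let $f,G\in C^0(M,\mathbb{R})$ with $G\ge 0$, let $Z\subseteq G^{-1}(0)$ be a compact subset on which $f$ is constant with value $\zeta\in\mathbb{R}$, and let $\Gamma$ be a class of $(f,G)$-gradient flow lines. Suppose $0\le E_0<\mathfrak{S}^+_{f,G}(Z)$ and $I=[a,\infty)$ satisfy conditions (A1$_{(E_0,I)}$) and (A2$_{(E_0,I)}$). Then for every sequence $(\gamma_n)_{n\in\mathbb{N}}\subseteq\mathcal{M}_{(E_0,I)}$ there exists a subsequence which converges in $C^0(I,M)$ to some $\gamma\in\mathcal{M}_{(E_0,I)}$.
   Context: A closed interval is an interval that is a closed subset of $\mathbb{R}$ and not a single point: $[a,b]$ with $a<b$, $(-\infty,a]$, $[a,\infty)$, or $\mathbb{R}$. Spectral gap: $\mathfrak{S}^+_{f,G}(Z):=\inf\{\zeta-f(x)\mid x\in G^{-1}(0)\setminus Z,\ f(x)\le\zeta\}\in[0,\infty]$, with $\inf\emptyset=+\infty$. Energy: for $\gamma\in C^0(I,M)$, $E(\gamma):=\int_I G(\gamma(s))\,ds\in[0,\infty]$. A class of $(f,G)$-gradient flow lines is a family $\Gamma=\{\Gamma(I)\}_I$ of sets indexed by the closed intervals $I\subseteq\mathbb{R}$ such that: (1) $\Gamma(I)\subseteq C^0(I,M)$; (2) for closed intervals $J\subseteq I$, restriction $\gamma\mapsto\gamma|_J$ maps $\Gamma(I)$ into $\Gamma(J)$; (3) $\{\gamma(\cdot+s_0)\mid\gamma\in\Gamma(I)\}=\Gamma(I-s_0)$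 for all $I$ and $s_0\in\mathbb{R}$; (4) for every $\gamma\in\Gamma(I)$, $f\circ\gamma\in C^1(I,\mathbb{R})$ and $(f\circ\gamma)'(s)=G(\gamma(s))$ for all $s\in I$. Moduli space: for $E_0\ge0$ and $I=[a,\infty)$, $\mathcal{M}_{(E_0,I)}:=\{\gamma\in\Gamma(I)\mid E(\gamma)\le E_0$ and the limit $\gamma(\infty):=\lim_{s\to\infty}\gamma(s)$ exists and lies in $Z\}$. $C^0_{\mathrm{loc}}(I,M)$ denotes $C^0(I,M)$ with the compact-open topology. For $\gamma_n,\gamma\in C^0([a,\infty),M)$ whose limits at $\infty$ exist, ''$\gamma_n\to\gamma$ in $C^0(I,M)$'' means that the continuous extensions $[a,\infty]\to M$ converge in the compact-open topology of $C^0([a,\infty],M)$ (equivalently, uniform convergence on $I$ for any metric inducing the topology of $M$). A coarse metric on a topological space $X$ is a metric $d:X\times X\to[0,\infty)$ whose induced topology is coarser than (contained in) the given topology. Topological notions without qualification always refer to the given topology. (A1$_{(E_0,I)}$): For every sequence $(\gamma_n)_n\subseteq\Gamma(I)$ with $E(\gamma_n)\le E_0$ for all $n$, there is a subsequence converging in $C^0_{\mathrm{loc}}(I,M)$ to some $\gamma\in\Gamma(I)$. (A2$_{(E_0,I)}$): For every $z\in Z$ there exist an open neighborhood $U\subseteq M$ of $z$ and a coarse metric $d$ on $U$ (with the subspace topology) such that: whenever $(s_n)_n\subseteq I$ tends to infinity and $(\gamma_n)_n\subseteq\mathcal{M}_{(E_0,I)}$ satisfies $\gamma_n(s)\in U$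 for all $s_n\le s\le\infty$ and all $n$, then if $(\gamma_n(s_n))_n$ converges to some point in $Z\cap U$, it follows that $d(\gamma_n(s_n),\gamma_n(\infty))\to0$. *)

(* Defs.v *)
From HB Require Import structures.
From mathcomp Require Import all_boot all_order all_algebra.
From mathcomp Require Import all_classical all_reals all_analysis.

Set Implicit Arguments.
Unset Strict Implicit.
Unset Printing Implicit Defensive.

Import Order.TTheory GRing.Theory Num.Theory.
Import numFieldNormedType.Exports.
Local Open Scope classical_set_scope.
Local Open Scope ring_scope.

(* A subset [A] of a topological space, used as a type, is the subtype
   [set_type A] with the library's subspace topology; in particular a path on
   [I : set R] is a function [I -> M] on that subtype, and [{compact-open, _ }]
   refers to the compact-open topology over it. *)

Section Metrics.
Context {R : realType} {X : topologicalType}.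
Implicit Types (d : X -> X -> R) (A : set X).

Definition is_metric d : Prop :=
  [/\ forall x y, 0 <= d x y,
      forall x y, d x y = 0 <-> x = y,
      forall x y, d x y = d y x &
      forall y x z, d x z <= d x y + d y z].

Definition metric_open d A : Prop :=
  forall x, A x -> exists2 e : R, 0 < e & [set y | d x y < e] `<=` A.

Definition coarse_metric d : Prop :=
  is_metric d /\ forall A, metric_open d A -> open A.

End Metrics.

Definition metrizable (R : realType) (X : topologicalType) : Prop :=
  exists d : X -> X -> R,
    is_metric d /\ forall A : set X, open A <-> metric_open d A.

Section Intervals.
Context {R : realType}.
Implicit Types (I J : set R) (a b s : R).

Definition closed_interval I : Prop :=
  [\/ exists a b, a < b /\ I = `[a, b]%classic,
      exists a, I = `]-oo, a]%classic,
      exists a, I = `[a, +oo[%classic |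
      I = [set: R] ].

Definition ray a : set R := `[a, +oo[%classic.

(* [a, oo], as a subspace of the extended real line. *)
Definition cray a : set (\bar R) := [set x | (a%:E <= x)%E].

Lemma set_inclP I J (JI : J `<=` I) (t : J) : set_val t \in I.
Proof. exact/mem_set/JI/set_valP. Qed.

Definition set_incl I J (JI : J `<=` I) (t : J) : I := SigSub (set_inclP JI t).

(* I - s *)
Definition shift_set s I : set R := [set t | I (t + s)].

Lemma set_shiftP s I (t : shift_set s I) : set_val t + s \in I.
Proof. exact/mem_set/(set_valP t). Qed.

Definition set_shift s I (t : shift_set s I) : I := SigSub (set_shiftP t).

Lemma ray_inclP a (t : ray a) : (set_val t)%:E \in cray a.
Proof.
apply/mem_set; have := set_valP t.
by rewrite /ray /= in_itv /= andbT /cray /= lee_fin.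
Qed.

Definition ray_incl a (t : ray a) : cray a := SigSub (ray_inclP t).

(* The trace on I of the neighborhood filter of +oo in R. *)
Definition at_infty I : set_system I :=
  [set P | \forall x \near +oo%R, forall t : I, set_val t = x -> P t].
Arguments at_infty I _ : clear implicits.

Global Instance at_infty_filter I : Filter (at_infty I).
Proof.
have FR : ProperFilter (pinfty_nbhs R) := proper_pinfty_nbhs; split.
- by apply: (@filterE _ +oo%R).
- move=> P Q; apply: (@filterS2 _ +oo%R) => x Px Qx t tx.
  by split; [exact: Px|exact: Qx].
- move=> P Q PQ; apply: (@filterS _ +oo%R) => x Px t tx.
  exact/PQ/Px.
Qed.

(* The derivative relative to I: one-sided at the endpoints of I. *)
Definition is_deriv_on I (u : I -> R) (s : I) (l : R) : Prop :=
  (u t - u s) / (set_val t - set_val s) @[t --> s^'] --> l.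

Definition C1_on I (u : I -> R) : Prop :=
  exists2 u' : I -> R, continuous u' & forall s : I, is_deriv_on u s (u' s).

End Intervals.
Arguments at_infty {R} I _.

Section Flow.
Context {R : realType} {M : topologicalType}.
Variables (f G : M -> R).

(* The values of Γ at sets that are not closed intervals are irrelevant: they
   are never used. *)
Record gradient_flow_class (Γ : forall I : set R, set (I -> M)) : Prop := {
  flow_continuous : forall (I : set R) (γ : I -> M),
    closed_interval I -> Γ I γ -> continuous γ ;
  flow_restrict : forall (I J : set R) (JI : J `<=` I) (γ : I -> M),
    closed_interval I -> closed_interval J ->
    Γ I γ -> Γ J (γ \o set_incl JI) ;
  flow_shift : forall (I : set R) (s : R), closed_interval I ->
    [set γ \o @set_shift R s I | γ in Γ I] = Γ (shift_set s I) ;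
  flow_deriv : forall (I : set R) (γ : I -> M), closed_interval I -> Γ I γ ->
    C1_on (f \o γ) /\ forall s : I, is_deriv_on (f \o γ) s (G (γ s))
}.

Definition spectral_gap (ζ : R) (Z : set M) : \bar R :=
  ereal_inf [set (ζ - f x)%:E | x in (G @^-1` [set 0] `\` Z) `&` [set x | f x <= ζ]].

(* [valL_ 0] extends the integrand by 0 outside I; the integral over I
   ignores these values. *)
Definition energy (I : set R) (γ : I -> M) : \bar R :=
  (\int[lebesgue_measure]_(s in I) valL_ 0%E (fun t : I => (G (γ t))%:E) s)%E.

Definition limit_at_infty (I : set R) (γ : I -> M) (z : M) : Prop :=
  γ @ at_infty I --> z.

Definition moduli (Γ : forall I : set R, set (I -> M)) (Z : set M)
    (E0 a : R) : set (ray a -> M) :=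
  [set γ | [/\ Γ (ray a) γ, (energy γ <= E0%:E)%E &
               exists2 z, Z z & limit_at_infty γ z]].

Definition conditionA1 (Γ : forall I : set R, set (I -> M))
    (E0 : R) (I : set R) : Prop :=
  forall γ_ : nat -> I -> M,
    (forall n, Γ I (γ_ n)) -> (forall n, (energy (γ_ n) <= E0%:E)%E) ->
    exists2 φ : nat -> nat, increasing_seq φ &
    exists2 γ : I -> M, Γ I γ & {compact-open, (γ_ \o φ) @ \oo --> γ}.

(* [p n] and [q n] are γ_n(s_n) and γ_n(oo) as points of U. *)
Definition conditionA2 (Γ : forall I : set R, set (I -> M)) (Z : set M)
    (E0 a : R) : Prop :=
  forall z, Z z -> exists U : set M, [/\ open U, U z &
    exists2 d : U -> U -> R, coarse_metric d &
    forall (s_ : nat -> ray a) (γ_ : nat -> ray a -> M) (p q : nat -> U),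
      set_val (s_ n) @[n --> \oo] --> +oo ->
      (forall n, moduli Γ Z E0 (γ_ n)) ->
      (forall n (s : ray a), set_val (s_ n) <= set_val s -> U (γ_ n s)) ->
      (forall n, set_val (p n) = γ_ n (s_ n)) ->
      (forall n, limit_at_infty (γ_ n) (set_val (q n))) ->
      (exists2 w, (Z `&` U) w & γ_ n (s_ n) @[n --> \oo] --> w) ->
      d (p n) (q n) @[n --> \oo] --> (0 : R)].

End Flow.

Section Convergence.
Context {R : realType} {M : topologicalType} (a : R).

Definition is_extension (γ : ray a -> M) (g : cray a -> M) : Prop :=
  continuous g /\ g \o @ray_incl R a = γ.

(* Convergence in C^0([a, oo), M) for paths with limits at oo. *)
Definition cvg_C0 (γ_ : nat -> ray a -> M) (γ : ray a -> M) : Prop :=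
  exists (g_ : nat -> cray a -> M) (g : cray a -> M),
    [/\ forall n, is_extension (γ_ n) (g_ n), is_extension γ g &
        {compact-open, g_ @ \oo --> g}].

End Convergence.

(* Main.v *)
Require Import Defs.
From HB Require Import structures.
From mathcomp Require Import all_boot all_order all_algebra.
From mathcomp Require Import all_classical all_reals all_analysis.
From mathcomp Require Import lra.

Set Implicit Arguments.
Unset Strict Implicit.
Unset Printing Implicit Defensive.

Import Order.TTheory GRing.Theory Num.Theory.
Import numFieldNormedType.Exports.
Local Open Scope classical_set_scope.
Local Open Scope ring_scope.

(** Along a flow line the height [f] increases at rate [G], so on a ray the
    energy of a flow line is its limiting height minus its initial height.
    A path of the moduli space ends at height [ζ], hence its heights lie in
    [[ζ - E0, ζ]]. This band is preserved by time shifts and by pointwise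
    limits, and (A1) applies to every sequence of shifted paths whose heights
    stay in it.

    The gap condition turns (A1) into information about limits at infinity.
    Shift paths by times tending to infinity in such a way that the heights
    become constant in the limit. The limit path then has constant height, so
    it starts at a zero of [G] in the band, and such a zero belongs to [Z]
    ([shifted_limit]). For a single path this shows that the height tends to
    [ζ] ([flow_height_limit]): no energy is lost at infinity by the limit [γ]
    given by (A1). For a convergent sequence of paths it then shows that the
    values at any times tending to infinity accumulate on [Z]
    ([escaping_limit]).

    Accumulation on [Z] does not yet give a single limit, since paths might
    drift along [Z]. Pass to a further subsequence whose endpoints converge to
    some [w] in [Z], by compactness. If the tails did not stay close to [w],
    then, since the endpoints do, infinitely many of the paths would cross a
    small sphere around [w] for a last time, at times tending to infinity. The
    crossing points accumulate at some [z] in [Z] on the sphere, and after its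
    last crossing each path stays in the neighborhood of [w] given by (A2). So
    the distance in (A2) between crossing points and endpoints tends to [0],
    which forces [z = w], a contradiction ([no_escape]).

    Hence the tails are uniformly close to [w] ([uniform_tail]). This gives
    both the limit of [γ] at infinity and, with uniform convergence on compact
    sets, convergence on the compactified ray ([compact_open_extension]). *)

(** * Subsequences *)

Lemma increasing_subsequence (P : nat -> nat -> Prop) :
  (forall k N, exists2 n, (N <= n)%N & P k n) ->
  exists2 φ : nat -> nat, increasing_seq φ & forall k, P k (φ k).
Proof.
move=> H; have /choice[g gP] : forall kN : nat * nat,
    exists n, (kN.2 <= n)%N /\ P kN.1 n.
  by move=> [k N]; have [n Nn Pn] := H k N; exists n.
pose φ := fix φ k := if k is k'.+1 then g (k, (φ k').+1) else g (0%N, 0%N).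
exists φ; first by apply/increasing_seqP => n; exact: (gP (_, _)).1.
by case=> [|k]; exact: (gP (_, _)).2.
Qed.

Lemma increasing_seq_cvg_infty (φ : nat -> nat) :
  increasing_seq φ -> φ n @[n --> \oo] --> \oo.
Proof.
move=> φi; have nφ n : (n <= φ n)%N.
  elim: n => // n /leq_ltn_trans; apply.
  by move/increasing_seqP : φi; exact.
by move=> A [N _ NA]; exists N => //= n Nn; apply: NA; exact: leq_trans (nφ n).
Qed.

(** * Metrics and topologies *)

Section metrics.
Context {R : realType} {X : topologicalType}.
Variable d : X -> X -> R.
Hypothesis d_coarse : coarse_metric d.

Lemma coarse_metric_near x (e : R) : 0 < e -> \forall y \near x, d x y < e.
Proof.
case: d_coarse => -[_ d0 _ dt] dop e0; rewrite -nbhs_nearE nbhsE.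
exists [set y | d x y < e] => //; split; last by rewrite /= (d0 x x).2.
apply: dop => y /= xy; exists (e - d x y); first by rewrite subr_gt0.
by move=> z /= yz; rewrite (le_lt_trans (dt y _ _))// -ltrBrDl.
Qed.

Lemma coarse_metric_continuous w : continuous (d w).
Proof.
case: (d_coarse) => -[_ d0 ds dt] _ x.
apply/cvgrPdist_lt => e e0; near=> y.
have xy : d x y < e by near: y; exact: coarse_metric_near.
have yx := dt y w x; have yx' := dt x w y; move: yx; rewrite (ds y x) => yx.
by rewrite ltr_norml; apply/andP; split; lra.
Unshelve. all: by end_near. Qed.

End metrics.

(** The half of metrizability that a coarse metric lacks: balls are small
    enough to refine the given neighborhoods. *)
Definition fine_metric (R : realType) (X : topologicalType) (d : X -> X -> R) :=
  forall x A, nbhs x A -> exists2 e : R, 0 < e & [set y | d x y < e] `<=` A.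

Lemma metrizable_metric (R : realType) (X : topologicalType) :
  metrizable R X -> exists2 d : X -> X -> R, coarse_metric d & fine_metric d.
Proof.
move=> [d [dm dop]]; exists d; first by split=> // A /dop.
move=> x A; rewrite nbhsE => -[B [/dop Bop Bx] BA].
by have [e e0 eB] := Bop _ Bx; exists e => //; exact: subset_trans BA.
Qed.

Lemma compact_subsequence (R : realType) (X : topologicalType) (d : X -> X -> R)
    (K : set X) (z_ : nat -> X) :
  coarse_metric d -> fine_metric d -> compact K -> (forall n, K (z_ n)) ->
  exists2 φ : nat -> nat, increasing_seq φ &
  exists2 z, K z & z_ (φ n) @[n --> \oo] --> z.
Proof.
move=> dc db Kc Kz.
have zK : (z_ @ \oo) K by exists 0%N => // n _; exact: Kz.
have [z [Kz' zc]] := Kc (z_ @ \oo) _ zK.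
have H k N : exists2 n, (N <= n)%N & d z (z_ n) < k.+1%:R^-1.
  have tailN : (z_ @ \oo) (z_ @` [set n | (N <= n)%N]).
    by exists N => // n /= Nn; exists n.
  have zk : nbhs z [set y | d z y < k.+1%:R^-1].
    by apply: (coarse_metric_near dc); rewrite invr_gt0 ltr0n.
  by have [_ [[n Nn <-] zn]] := zc _ _ tailN zk; exists n.
have [φ φi φP] := increasing_subsequence H.
exists φ => //; exists z => // A /db[e e0 eA].
suff : \forall n \near \oo, A (z_ (φ n)) by [].
near=> n; apply: eA => /=; apply: (lt_trans (φP n)).
near: n; exact: near_infty_natSinv_lt (PosNum e0).
Unshelve. all: by end_near. Qed.

Lemma subtype_cvg (X : topologicalType) (U : set X) (T : Type)
    (F : set_system T) (FF : Filter F) (p : T -> U) (x : U) :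
  set_val (p t) @[t --> F] --> set_val x -> p @ F --> x.
Proof.
move=> px A; rewrite nbhsE => -[_ [[B Bo <-] Bx] BA].
have : nbhs (set_val x) B by exact: open_nbhs_nbhs.
move/px => pB; have {}pB : F [set t | B (set_val (p t))] := pB.
suff : F (p @^-1` A) by [].
by apply: filterS pB => t Bt; exact: BA.
Qed.

Lemma compact_open_pointwise (X Y : topologicalType) (u_ : nat -> X -> Y) (u : X -> Y) :
  {compact-open, u_ @ \oo --> u} -> forall x, u_ n x @[n --> \oo] --> u x.
Proof.
move=> /compact_open_cvgP uu x A; rewrite nbhsE => -[B [Bo Bx] BA].
have [|N _ H] := uu [set x] B (@compact_set1 _ x) Bo.
  by move=> _ [_ -> <-].
by exists N => // n /H; rewrite /= => HB; apply/BA/HB; exists x.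
Qed.

(** The crossing time is the supremum of the times at which [h] is at least
    [r]; continuity from both sides gives the value [r] there. *)
Lemma last_crossing (R : realType) (h : R -> R) (r x0 : R) :
  continuous h -> r <= h x0 -> (\forall x \near +oo, h x < r) ->
  exists t, [/\ x0 <= t, h t = r & forall x, t < x -> h x < r].
Proof.
move=> ch rh [b [_ hb]]; pose A := [set x | r <= h x].
have ubA : ubound A b.
  by move=> x /= rx; rewrite leNgt; apply/negP => /hb; rewrite ltNge rx.
have supA : has_sup A by split; [exists x0|exists b].
have ltr x : sup A < x -> h x < r.
  move=> Ax; rewrite ltNge; apply/negP => rx; move: Ax; rewrite ltNge => /negP; apply.
  exact: (sup_upper_bound supA).
exists (sup A); split => //; first exact: (sup_upper_bound supA).
apply/eqP; rewrite eq_le; apply/andP; split.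
  have hr : h y @[y --> (sup A)^'+] --> h (sup A) by apply: cvg_within_filter; exact: ch.
  apply: (cvgr_to_le hr).
  near=> y; apply/ltW/ltr; near: y; exact: nbhs_right_gt.
rewrite leNgt; apply/negP => hlt.
have : \forall y \near sup A, h y < r by apply: cvgr_lt (ch _) _ hlt.
move=> /nbhs_ballP[e /= e0 eA].
have [x Ax xe] := sup_adherent e0 supA.
have : h x < r.
  apply: eA; rewrite /ball/= ger0_norm ?subr_ge0; last exact: (sup_upper_bound supA).
  by rewrite ltrBlDr addrC -ltrBlDr.
by rewrite ltNge Ax.
Unshelve. all: by end_near. Qed.

(** * Paths on a ray and their extensions to infinity *)

Section clamp.
Context {R : realType} {M : topologicalType} (a : R).

Lemma clampP (x : R) : Num.max a x \in ray a.
Proof. by apply/mem_set; rewrite /ray /= in_itv /= andbT le_max lexx. Qed.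

(** The retraction of the line onto the ray: composing with it turns a path on
    the subtype [ray a] into a function on the whole line, to which calculus on
    the line applies. *)
Definition clamp (x : R) : ray a := SigSub (clampP x).

Lemma clampE x : set_val (clamp x) = Num.max a x.
Proof. by []. Qed.

Lemma ray_ge (t : ray a) : a <= set_val t.
Proof. by have := set_valP t; rewrite /ray /= in_itv /= andbT. Qed.

Lemma clamp_id x : a <= x -> set_val (clamp x) = x.
Proof. by move=> ax; rewrite clampE; apply/max_idPr. Qed.

Lemma ray_valK : cancel (set_val : ray a -> R) clamp.
Proof. by move=> t; apply: val_inj => /=; apply: clamp_id; exact: ray_ge. Qed.

Lemma clamp_continuous : continuous clamp.
Proof.
apply: continuous_comp_initial => x.
by apply: (@continuous_max _ _ (cst a) id) => //; exact: cvg_cst.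
Qed.

Lemma limit_at_inftyE (γ : ray a -> M) (z : M) :
  limit_at_infty γ z <-> γ (clamp x) @[x --> +oo%R] --> z.
Proof.
split=> h A /h hA.
- have {}hA : \forall x \near +oo%R, forall t : ray a, set_val t = x -> A (γ t).
    exact: hA.
  suff : \forall x \near +oo%R, A (γ (clamp x)) by [].
  near=> x; have ax : a <= x by near: x; apply: nbhs_pinfty_ge; rewrite num_real.
  have : forall t : ray a, set_val t = x -> A (γ t) by near: x.
  by apply; exact: clamp_id.
- have {}hA : \forall x \near +oo%R, A (γ (clamp x)) by exact: hA.
  suff : \forall x \near +oo%R, forall t : ray a, set_val t = x -> A (γ t) by [].
  by apply: filterS hA => x Ax t tx; rewrite -(ray_valK t) tx.
Unshelve. all: by end_near. Qed.

End clamp.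

Section extension.
Context {R : realType} {M : topologicalType} (a : R).
Implicit Types (γ : ray a -> M) (z : M).

(** Defined on the whole extended line, where continuity can be checked on the
    three kinds of neighborhood filters. *)
Definition ereal_extension γ z (x : \bar R) : M :=
  match x with r%:E => γ (clamp a r) | +oo%E => z | -oo%E => γ (clamp a a) end.

Definition extension γ z : cray a -> M := ereal_extension γ z \o set_val.

Lemma ereal_extension_continuous γ z :
  continuous γ -> limit_at_infty γ z -> continuous (ereal_extension γ z).
Proof.
move=> γc /limit_at_inftyE γz [r| |] A hA.
- have : nbhs r [set x | A (γ (clamp a x))].
    have := continuous_comp (@clamp_continuous R a r) (γc (clamp a r)).
    exact.
  by [].
- have [b [bR bA]] : \forall x \near +oo, A (γ (clamp a x)) := γz _ hA.
  exists b; split => // -[r| |]//=.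
  + by rewrite lte_fin; exact: bA.
  + by move=> _; exact: nbhs_singleton.
- exists a; split; first by rewrite num_real.
  move=> [r| |]//= ra; last exact: nbhs_singleton.
  rewrite lte_fin in ra.
  have -> : clamp a r = clamp a a.
    by apply: val_inj => /=; rewrite maxxx; apply/max_idPl/ltW.
  exact: nbhs_singleton.
Qed.

Lemma extensionP γ z :
  continuous γ -> limit_at_infty γ z -> is_extension γ (extension γ z).
Proof.
move=> γc γz; split.
  move=> x; apply: continuous_comp; first exact: initial_continuous.
  exact: ereal_extension_continuous.
by apply/funext => t; rewrite /= /extension/= ray_valK.
Qed.

(** A compact subset of [[a, +oo]] splits into a bounded part, which is handled by
    convergence on compact subsets of the ray, and a part close to infinity. If
    the compact set contains infinity, the latter is handled by the uniform
    tails; otherwise it can be chosen empty. *)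
Lemma compact_open_extension (γ_ : nat -> ray a -> M) γ (z_ : nat -> M) z :
  {compact-open, γ_ @ \oo --> γ} -> continuous γ -> limit_at_infty γ z ->
  z_ @ \oo --> z ->
  (forall O, nbhs z O ->
     exists N S, forall n x, (N <= n)%N -> S <= x -> O (γ_ n (clamp a x))) ->
  {compact-open, (fun n => extension (γ_ n) (z_ n)) @ \oo --> extension γ z}.
Proof.
move=> /compact_open_cvgP γγ γc γz zz tail.
apply/compact_open_cvgP => K O Kc Oo KO.
have [S [N KS]] : exists S N, forall n (x : cray a), (N <= n)%N -> K x ->
    (S%:E <= set_val x)%E -> O (extension (γ_ n) (z_ n) x).
  have [[x0 [Kx0 x0oo]]|Koo] := pselect (exists x : cray a, K x /\ set_val x = +oo%E).
    have Oz : nbhs z O.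
      apply: open_nbhs_nbhs; split => //; apply: KO; exists x0 => //.
      by rewrite /extension/= x0oo.
    have [N1 [S H]] := tail _ Oz; have [N2 _ H2] := zz _ Oz.
    exists S, (maxn N1 N2) => n x; rewrite geq_max => /andP[n1 n2] _.
    rewrite /extension/=; case: (set_val x) => [r| |]//=.
    - by rewrite lee_fin => ?; exact: H.
    - by move=> _; exact: H2.
  (* K is closed and misses infinity, hence is bounded. *)
  have KR : closed (set_val @` K : set (\bar R)).
    apply: compact_closed; first exact: ereal_hausdorff.
    apply: continuous_compact => //.
    by apply: continuous_subspaceT; exact: initial_continuous.
  have : nbhs +oo%E (~` (set_val @` K : set (\bar R))).
    apply: open_nbhs_nbhs; split; first exact: closed_openC.
    by move=> [x Kx xoo]; apply: Koo; exists x.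
  move=> [S [_ HS]]; exists (S + 1), 0%N => n x _ Kx Sx.
  exfalso; apply: (HS (set_val x)); last by exists x.
  by apply: lt_le_trans Sx; rewrite lte_fin ltrDl.
pose L : set (cray a) := [set x | (set_val x <= S%:E)%E].
have Lclosed : closed L.
  apply: (closed_comp (f := set_val) (D := [set x : \bar R | (x <= S%:E)%E])).
    by move=> x _; exact: initial_continuous.
  exact: closed_ereal_ge_ereal.
(* On the bounded part, c is the inverse of the inclusion of the ray. *)
pose c (x : cray a) : ray a := clamp a (fine (set_val x)).
have Lfin x : L x -> exists r, a <= r /\ set_val x = r%:E.
  rewrite /L/=; have : (a%:E <= set_val x)%E by exact: set_valP x.
  case: (set_val x) => [r| |]; last by rewrite leeNy_eq.
    by rewrite lee_fin => ar _; exists r.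
  by move=> _; rewrite leye_eq.
have KLc : compact (c @` (K `&` L)).
  apply: continuous_compact; last exact: compact_closedI.
  apply: continuous_in_subspaceT => x; rewrite inE => -[_ /Lfin[r [_ xr]]].
  have H : fine (set_val y) @[y --> x] --> r.
    have Hx : set_val y @[y --> x] --> r%:E by rewrite -xr; exact: initial_continuous.
    exact: fine_cvg Hx.
  have := cvg_comp _ _ H (@clamp_continuous R a r).
  by rewrite /continuous_at /c xr.
have cE γ' z' x : L x -> extension γ' z' x = γ' (c x).
  by move=> /Lfin[r [_ xr]]; rewrite /extension /c/= xr.
have cO : [set γ x | x in c @` (K `&` L)] `<=` O.
  move=> _ [_ [x [Kx Lx] <-] <-]; rewrite -(cE _ z)//.
  by apply: KO; exists x.
have := γγ _ _ KLc Oo cO.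
move=> [N' _ HN']; exists (maxn N N') => //= n; rewrite /= geq_max => /andP[nN nN'].
move=> _ [x Kx <-]; have [xS|/ltW Sx] := leP (set_val x) S%:E; last exact: (KS n).
rewrite cE//; apply: (HN' n nN'); exists (c x) => //; by exists x.
Qed.

End extension.

(** * Flow lines on a ray *)

Section flow_lines.
Context {R : realType} {M : topologicalType}.
Variables (f G : M -> R) (Γ : forall I : set R, set (I -> M)) (a : R).
Arguments Γ I _ : clear implicits.
Hypothesis f_continuous : continuous f.
Hypothesis G_continuous : continuous G.
Hypothesis G_ge0 : forall x, 0 <= G x.
Hypothesis Γ_flow : gradient_flow_class f G Γ.

Lemma closed_interval_ray (b : R) : closed_interval (ray b).
Proof. by apply: Or43; exists b. Qed.

(** Derivatives relative to the ray are limits along an arbitrary parameter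
    [g]; this covers two-sided derivatives at interior points and right
    derivatives at the endpoint. *)
Lemma deriv_on_cvg (u : ray a -> R) (x l : R) (T : Type) (F : set_system T)
    (FF : Filter F) (g : T -> R) :
  a <= x -> is_deriv_on u (clamp a x) l ->
  (\forall y \near F, a <= g y /\ g y != x) -> g y @[y --> F] --> x ->
  (u (clamp a (g y)) - u (clamp a x)) / (g y - x) @[y --> F] --> l.
Proof.
move=> ax ul gx gl.
have cl : clamp a (g y) @[y --> F] --> (clamp a x)^'.
  move=> A; rewrite /dnbhs /within/= => hA.
  have : (clamp a (g y)) @[y --> F] --> clamp a x.
    exact: (cvg_comp _ _ gl (@clamp_continuous R a x)).
  move=> /(_ _ hA); apply: filterS2 gx => y [ay yx] /= /(_ _); apply.
  apply: contra yx => /eqP/(congr1 set_val).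
  by rewrite !clamp_id// => ->.
apply: (cvg_trans _ (cvg_comp _ _ cl ul)).
apply: near_eq_cvg; apply: filterS gx => y [ay _] /=.
by rewrite (clamp_id ax) (clamp_id ay).
Qed.

Variable γ : ray a -> M.
Hypothesis Γγ : Γ (ray a) γ.

Lemma flow_clamp_continuous : continuous (γ \o clamp a).
Proof.
move=> x; apply: continuous_comp; first exact: clamp_continuous.
exact: (flow_continuous Γ_flow (closed_interval_ray a) Γγ).
Qed.

Lemma flow_height_continuous : continuous (fun x => f (γ (clamp a x))).
Proof.
move=> x; apply: (@continuous_comp _ _ _ (γ \o clamp a) f).
  exact: flow_clamp_continuous.
exact: f_continuous.
Qed.

Lemma flow_is_derive x : a < x ->
  is_derive x 1 (fun y => f (γ (clamp a y))) (G (γ (clamp a x))).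
Proof.
move=> ax; have [_ fd] := flow_deriv Γ_flow (closed_interval_ray a) Γγ.
have H : h^-1 *: (f (γ (clamp a (h *: (1 : R) + x))) - f (γ (clamp a x)))
    @[h --> (0:R)^'] --> G (γ (clamp a x)).
  have hx : h *: (1 : R) + x @[h --> (0:R)^'] --> x.
    have -> : (fun h : R => h *: (1 : R) + x) = (fun h => h + x).
      by apply/funext => h; rewrite /GRing.scale/= mulr1.
    have : h + x @[h --> (0:R)] --> 0 + x by apply: cvgD; [exact: cvg_id|exact: cvg_cst].
    by rewrite add0r => hx; exact: cvg_within_filter.
  apply: (cvg_trans _ (@deriv_on_cvg _ _ _ _ _ _
    (fun h : R => h *: (1 : R) + x) (ltW ax) (fd _) _ hx)).
    apply: near_eq_cvg; near=> h.
    by rewrite /= addrK /GRing.scale/= mulr1 mulrC.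
  have h1 : \forall h \near (0:R)^', a <= h *: (1 : R) + x.
    exact: cvgr_ge hx _ ax.
  near=> h; split; first by near: h.
  rewrite /GRing.scale/= mulr1 -subr_eq0 addrK.
  by near: h; exact: nbhs_dnbhs_neq.
apply: DeriveDef; first by apply/cvg_ex; exists (G (γ (clamp a x))).
exact: cvg_lim H.
Unshelve. all: by end_near. Qed.

Lemma flow_height_homo : {homo (fun x => f (γ (clamp a x))) : x y / x <= y}.
Proof.
have H x y : a <= x -> x <= y -> f (γ (clamp a x)) <= f (γ (clamp a y)).
  move=> ax xy.
  have [||c _ E] := @MVT_segment R (fun x => f (γ (clamp a x)))
    (fun x => G (γ (clamp a x))) x y xy.
  - by move=> z; rewrite in_itv/= => /andP[xz _]; apply/flow_is_derive/(le_lt_trans ax).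
  - exact/continuous_subspaceT/flow_height_continuous.
  by rewrite -subr_ge0 E mulr_ge0// subr_ge0.
move=> x y xy /=.
have E z : clamp a z = clamp a (Num.max a z).
  by apply: val_inj => /=; rewrite maxA maxxx.
rewrite (E x) (E y); apply: H; first by rewrite le_max lexx.
by rewrite ge_max !le_max lexx/= xy orbT.
Qed.

(** The fundamental theorem of calculus on the ray. *)
Lemma flow_energyE (l : R) : f (γ (clamp a x)) @[x --> +oo%R] --> l ->
  energy G γ = (l - f (γ (clamp a a)))%:E.
Proof.
move=> Fl; rewrite /energy.
transitivity (\int[lebesgue_measure]_(s in ray a) (G (γ (clamp a s)))%:E)%E.
  apply: eq_integral => s; rewrite inE /ray/= in_itv/= andbT => /clamp_id sE.
  rewrite -{1}sE; have := valLK (0%E : \bar R) (fun t : ray a => (G (γ t))%:E).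
  by move/(congr1 (@^~ (clamp a s))).
rewrite /ray (@ge0_continuous_FTC2y _ _ (fun x => f (γ (clamp a x))) _ l)//.
- apply: continuous_subspaceT => x.
  apply: (@continuous_comp _ _ _ (γ \o clamp a) G).
    exact: flow_clamp_continuous.
  exact: G_continuous.
- by move=> x ax; have := flow_is_derive ax; case.
- by apply: cvg_within_filter; exact: flow_height_continuous.
- move=> x; rewrite in_itv/= andbT => ax.
  have := flow_is_derive ax => ?; rewrite derive1E; exact: derive_val.
Qed.

Lemma flow_height_cst_G0 (c : R) : (forall t, f (γ t) = c) -> G (γ (clamp a a)) = 0.
Proof.
move=> fc; have [_ fd] := flow_deriv Γ_flow (closed_interval_ray a) Γγ.
have aa : y @[y --> a^'+] --> a by apply: cvg_within_filter; exact: cvg_id.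
have ya : \forall y \near a^'+, a <= y /\ y != a.
  near=> y; have ay : a < y by near: y; exact: nbhs_right_gt.
  by rewrite ltW// gt_eqF.
have := deriv_on_cvg _ (lexx a) (fd _) ya aa.
under eq_fun do rewrite /= !fc subrr mul0r.
move=> H; have {}H : cst 0 @ a^'+ --> G (γ (clamp a a)) by exact: H.
by rewrite -(cvg_lim (@Rhausdorff R) H) lim_cst.
Unshelve. all: by end_near. Qed.

(** Shifting the ray by [s] gives a longer ray, which is then restricted. *)
Lemma flow_shift_ray (s : R) : 0 <= s ->
  Γ (ray a) (fun t => γ (clamp a (set_val t + s))).
Proof.
move=> s0.
have E : shift_set s (ray a) = ray (a - s).
  by apply/seteqP; split=> t; rewrite /shift_set /ray/= !in_itv/= !andbT lerBlDr.
have sub : ray a `<=` shift_set s (ray a).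
  move=> t; rewrite E /ray/= !in_itv/= !andbT; apply: le_trans.
  by rewrite lerBlDr lerDl.
have H : Γ (shift_set s (ray a)) (γ \o @set_shift R s (ray a)).
  by rewrite -(flow_shift Γ_flow s (closed_interval_ray a)); exists γ.
have ci : closed_interval (shift_set s (ray a)).
  by rewrite E; exact: closed_interval_ray.
have := flow_restrict Γ_flow sub ci (closed_interval_ray a) H.
congr (Γ (ray a) _); apply/funext => t /=; congr γ; apply: val_inj => /=.
by apply/esym/max_idPr/(le_trans (ray_ge t)); rewrite lerDl.
Qed.

End flow_lines.

(** * Limits of paths shifted towards infinity *)

Section limits.
Context {R : realType} {M : topologicalType}.
Variables (f G : M -> R) (Z : set M) (ζ : R).
Variables (Γ : forall I : set R, set (I -> M)) (E0 a : R).
Arguments Γ I _ : clear implicits.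
Hypothesis f_continuous : continuous f.
Hypothesis G_continuous : continuous G.
Hypothesis G_ge0 : forall x, 0 <= G x.
Hypothesis f_Z : forall z, Z z -> f z = ζ.
Hypothesis Γ_flow : gradient_flow_class f G Γ.
Hypothesis E0_gap : (E0%:E < spectral_gap f G ζ Z)%E.
Hypothesis A1 : conditionA1 G Γ E0 (ray a).

Lemma gap_zero x : G x = 0 -> ζ - E0 <= f x <= ζ -> Z x.
Proof.
move=> Gx /andP[fx1 fx2]; apply: contrapT => Zx.
move: E0_gap; rewrite ltNge => /negP; apply.
apply: (@le_trans _ _ (ζ - f x)%:E); last by rewrite lee_fin; lra.
by apply: ereal_inf_lbound; exists x.
Qed.

Lemma height_cvg γ : Γ (ray a) γ -> (forall t, f (γ t) <= ζ) ->
  exists2 l, l <= ζ & f (γ (clamp a x)) @[x --> +oo%R] --> l.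
Proof.
move=> Γγ fζ; exists (sup (range (fun x => f (γ (clamp a x))))).
  apply: ge_sup; first by exists (f (γ (clamp a 0))), 0.
  by move=> _ [x _ <-].
apply: nondecreasing_cvgr; first exact: (flow_height_homo f_continuous G_ge0 Γ_flow).
by exists ζ => _ [x _ <-].
Qed.

Lemma moduli_height γ : moduli G Γ Z E0 γ ->
  f (γ (clamp a x)) @[x --> +oo%R] --> ζ /\ (forall t, ζ - E0 <= f (γ t) <= ζ).
Proof.
move=> [Γγ Eγ [z Zz /limit_at_inftyE γz]].
have Fζ : f (γ (clamp a x)) @[x --> +oo%R] --> ζ.
  by rewrite -(f_Z Zz); apply: (cvg_comp _ _ γz); exact: f_continuous.
split=> // t; have H := flow_height_homo f_continuous G_ge0 Γ_flow Γγ.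
apply/andP; split.
  move: Eγ; rewrite (flow_energyE f_continuous G_continuous G_ge0 Γ_flow Γγ Fζ) lee_fin => Eγ.
  have := H _ _ (ray_ge t); rewrite /= ray_valK; lra.
apply: (cvgr_to_ge Fζ).
near=> x; rewrite -(ray_valK t); apply: H.
by near: x; apply: nbhs_pinfty_ge; rewrite num_real.
Unshelve. all: by end_near. Qed.

(** The limit path supplied by (A1) has constant height [c], so [G] vanishes at
    its starting point, which the gap condition then places in [Z]. The
    energy of a shifted path is a difference of two heights in a band of width
    [E0], which is why (A1) applies. *)
Lemma shifted_limit (γ_ : nat -> ray a -> M) (s_ : nat -> R) (c : R) :
  (forall k, Γ (ray a) (γ_ k)) -> (forall k t, ζ - E0 <= f (γ_ k t) <= ζ) ->
  (forall k, a <= s_ k) ->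
  (forall t, a <= t -> f (γ_ k (clamp a (t + (s_ k - a)))) @[k --> \oo] --> c) ->
  exists2 φ : nat -> nat, increasing_seq φ &
  exists z, [/\ Z z, f z = c & γ_ (φ k) (clamp a (s_ (φ k))) @[k --> \oo] --> z].
Proof.
move=> Γγ fγ as_ fc.
pose δ k (t : ray a) := γ_ k (clamp a (set_val t + (s_ k - a))).
have Γδ k : Γ (ray a) (δ k).
  by apply: (flow_shift_ray Γ_flow (Γγ k)); rewrite subr_ge0.
have Eδ k : (energy G (δ k) <= E0%:E)%E.
  have fδ t : f (δ k t) <= ζ by have /andP[] := fγ k (clamp a (set_val t + (s_ k - a))).
  have [l lζ lE] := height_cvg (Γδ k) fδ.
  rewrite (flow_energyE f_continuous G_continuous G_ge0 Γ_flow (Γδ k) lE) lee_fin.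
  have /andP[] := fγ k (clamp a (set_val (clamp a a) + (s_ k - a))); rewrite /δ; lra.
have [φ φi [γ' Γγ' /compact_open_pointwise γγ']] := A1 Γδ Eδ.
exists φ => //; exists (γ' (clamp a a)).
have φoo := increasing_seq_cvg_infty φi.
have fγ'c t : f (γ' t) = c.
  have H1 := cvg_comp _ _ (γγ' t) (@f_continuous _).
  have H2 := cvg_comp _ _ φoo (fc _ (ray_ge t)).
  exact: (cvg_unique (@Rhausdorff R) H1 H2).
have fc' : ζ - E0 <= c <= ζ.
  have /= H2 := cvg_comp _ _ φoo (fc _ (lexx a)).
  apply/andP; split.
    apply: (cvgr_to_ge H2).
    by apply: nearW => k /=; have /andP[] := fγ (φ k) (clamp a (a + (s_ (φ k) - a))).
  apply: (cvgr_to_le H2).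
  by apply: nearW => k /=; have /andP[] := fγ (φ k) (clamp a (a + (s_ (φ k) - a))).
split=> //.
- apply: gap_zero; last by rewrite fγ'c.
  exact: (flow_height_cst_G0 Γ_flow Γγ' fγ'c).
- have := γγ' (clamp a a); rewrite /δ.
  by under eq_fun do rewrite /= clamp_id// addrC subrK.
Qed.

(** Monotonicity gives some limiting height; shifting [γ] by integers reveals
    that this height is attained on [Z]. *)
Lemma flow_height_limit γ : Γ (ray a) γ -> (forall t, ζ - E0 <= f (γ t) <= ζ) ->
  f (γ (clamp a x)) @[x --> +oo%R] --> ζ.
Proof.
move=> Γγ fγ; have fγζ t : f (γ t) <= ζ by have /andP[] := fγ t.
have [l _ lE] := height_cvg Γγ fγζ.
have H t : a <= t -> f (γ (clamp a (t + ((a + k%:R) - a)))) @[k --> \oo] --> l.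
  move=> _; apply: ((cvg_pinftyP _ _).1 lE).
  under eq_fun do rewrite (addrAC a) subrr add0r.
  apply/cvgryPge => b; near=> k.
  rewrite -lerBlDl; near: k; exact: nbhs_infty_ger.
have ak k : a <= a + k%:R by rewrite lerDl.
have [φ _ [z [Zz fz _]]] := shifted_limit (fun=> Γγ) (fun=> fγ) ak H.
by rewrite -(f_Z Zz) fz.
Unshelve. all: by end_near. Qed.

Section escaping.
Variables (β : nat -> ray a -> M) (γ : ray a -> M).
Hypothesis βm : forall n, moduli G Γ Z E0 (β n).
Hypothesis Γγ : Γ (ray a) γ.
Hypothesis βγ : forall t, β n t @[n --> \oo] --> γ t.

Lemma limit_height t : ζ - E0 <= f (γ t) <= ζ.
Proof.
have fβ := cvg_comp _ _ (@βγ t) (@f_continuous _).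
apply/andP; split.
  apply: (cvgr_to_ge fβ).
  by apply: nearW => k /=; have [_ /(_ t)/andP[]] := moduli_height (βm k).
apply: (cvgr_to_le fβ).
by apply: nearW => k /=; have [_ /(_ t)/andP[]] := moduli_height (βm k).
Qed.

(** The height of [γ] tends to [ζ], so at a fixed late time the paths [β n] are
    already close to height [ζ] for large [n], and by monotonicity they are so
    at all later times. *)
Lemma escaping_limit (n_ : nat -> nat) (s_ : nat -> R) :
  n_ @ \oo --> \oo -> (forall k, a <= s_ k) -> s_ @ \oo --> +oo ->
  exists2 φ : nat -> nat, increasing_seq φ &
  exists2 z, Z z & β (n_ (φ k)) (clamp a (s_ (φ k))) @[k --> \oo] --> z.
Proof.
move=> noo sa soo.
have ΓB k : Γ (ray a) (β (n_ k)) by have [] := βm (n_ k).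
have fB k t : ζ - E0 <= f (β (n_ k) t) <= ζ by have [_] := moduli_height (βm (n_ k)).
have H t : a <= t ->
    f (β (n_ k) (clamp a (t + (s_ k - a)))) @[k --> \oo] --> ζ.
  move=> ta; apply/cvgrPdist_lt => e e0.
  have /cvgrPdist_lt/(_ _ e0) := flow_height_limit Γγ limit_height.
  move=> [b [_ /(_ (b + 1))]]; rewrite ltrDl ltr01 => /(_ isT) fb.
  have := cvg_comp _ _ (cvg_comp _ _ noo (@βγ (clamp a (b + 1)))) (@f_continuous _).
  have fb' : ζ - e < f (γ (clamp a (b + 1))).
    by move: fb => /=; rewrite ltr_norml => /andP[]; lra.
  move=> /(cvgr_gt _)/(_ _ fb') Hk; near=> k.
  have /andP[_ fk] := fB k (clamp a (t + (s_ k - a))).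
  have : ζ - e < f (β (n_ k) (clamp a (b + 1))) by near: k.
  have : f (β (n_ k) (clamp a (b + 1))) <= f (β (n_ k) (clamp a (t + (s_ k - a)))).
    apply: (flow_height_homo f_continuous G_ge0 Γ_flow (ΓB k)).
    have : b + 1 <= s_ k by near: k; move/cvgryPge : soo; apply.
    lra.
  by move=> h1 h2; rewrite ger0_norm; lra.
have [φ φi [z [Zz _ zE]]] := shifted_limit ΓB fB sa H.
by exists φ => //; exists z.
Unshelve. all: by end_near. Qed.

End escaping.
End limits.

(** * Tails close to infinity *)

Section tails.
Context {R : realType} {M : topologicalType}.
Variables (f G : M -> R) (Z : set M) (ζ : R).
Variables (Γ : forall I : set R, set (I -> M)) (E0 a : R).
Arguments Γ I _ : clear implicits.
Hypothesis f_continuous : continuous f.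
Hypothesis G_continuous : continuous G.
Hypothesis G_ge0 : forall x, 0 <= G x.
Hypothesis f_Z : forall z, Z z -> f z = ζ.
Hypothesis Γ_flow : gradient_flow_class f G Γ.
Hypothesis E0_gap : (E0%:E < spectral_gap f G ζ Z)%E.
Hypothesis A1 : conditionA1 G Γ E0 (ray a).
Hypothesis A2 : conditionA2 G Γ Z E0 a.

(** The property of [d] that (A2) provides near each point of [Z]. *)
Definition tails_collapse (U : set M) (d : U -> U -> R) : Prop :=
  forall (s_ : nat -> ray a) (γ_ : nat -> ray a -> M) (p q : nat -> U),
    set_val (s_ n) @[n --> \oo] --> +oo ->
    (forall n, moduli G Γ Z E0 (γ_ n)) ->
    (forall n (s : ray a), set_val (s_ n) <= set_val s -> U (γ_ n s)) ->
    (forall n, set_val (p n) = γ_ n (s_ n)) ->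
    (forall n, limit_at_infty (γ_ n) (set_val (q n))) ->
    (exists2 w, (Z `&` U) w & γ_ n (s_ n) @[n --> \oo] --> w) ->
    d (p n) (q n) @[n --> \oo] --> (0 : R).

Variable d : M -> M -> R.
Hypothesis d_coarse : coarse_metric d.
Hypothesis d_fine : fine_metric d.
Variables (β : nat -> ray a -> M) (γ : ray a -> M) (z_ : nat -> M) (w : M).
Hypothesis βm : forall n, moduli G Γ Z E0 (β n).
Hypothesis βz : forall n, limit_at_infty (β n) (z_ n).
Hypothesis Γγ : Γ (ray a) γ.
Hypothesis βγ : forall t, β n t @[n --> \oo] --> γ t.
Hypothesis zw : z_ @ \oo --> w.
Hypothesis Zw : Z w.

(** The crossing points accumulate at a point [z] of [Z] at distance [r] from
    [w]. The endpoints tend to [w], and the distance of (A2) between crossing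
    points and endpoints tends to [0]; as that distance is continuous and
    separates points, [z = w]. *)
Lemma no_escape (U : set M) (dU : U -> U -> R) (r : R) (n_ : nat -> nat) (t_ : nat -> R) :
  U w -> coarse_metric dU -> tails_collapse dU ->
  0 < r -> (forall x, d w x <= r -> U x) ->
  n_ @ \oo --> \oo -> t_ @ \oo --> +oo -> (forall k, a <= t_ k) ->
  (forall k, d w (z_ (n_ k)) <= r) ->
  (forall k, d w (β (n_ k) (clamp a (t_ k))) = r) ->
  (forall k x, t_ k < x -> d w (β (n_ k) (clamp a x)) <= r) -> False.
Proof.
move=> Uw dUc hU r0 rU noo too ta zr tr xr.
have [φ φi [z Zz zE]] := escaping_limit f_continuous G_continuous G_ge0 f_Z
  Γ_flow E0_gap A1 βm Γγ βγ noo ta too.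
have dwz : d w z = r.
  have H := cvg_comp _ _ zE (coarse_metric_continuous d_coarse (w := w) (x := z)).
  have H' : d w (β (n_ (φ k)) (clamp a (t_ (φ k)))) @[k --> \oo] --> r.
    by under eq_fun do rewrite tr; exact: cvg_cst.
  exact: (cvg_unique (@Rhausdorff R) H H').
have Uz : U z by apply: rU; rewrite dwz.
have Up k : β (n_ (φ k)) (clamp a (t_ (φ k))) \in U by apply/mem_set/rU; rewrite tr.
have Uq k : z_ (n_ (φ k)) \in U by apply/mem_set/rU.
pose p k : U := SigSub (Up k); pose q k : U := SigSub (Uq k).
pose z' : U := SigSub (mem_set Uz); pose w' : U := SigSub (mem_set Uw).
have φoo := increasing_seq_cvg_infty φi.
have pq : dU (p k) (q k) @[k --> \oo] --> (0 : R).
  apply: (hU (fun k => clamp a (t_ (φ k))) (fun k => β (n_ (φ k)))) => //.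
  - have -> : (fun k => set_val (clamp a (t_ (φ k)))) = t_ \o φ.
      by apply/funext => k; rewrite clamp_id.
    exact: (cvg_comp _ _ φoo too).
  - move=> k s; rewrite clamp_id// => ts; apply: rU.
    move: ts; rewrite le_eqVlt => /predU1P[E|/xr]; last by rewrite ray_valK.
    have -> : s = clamp a (t_ (φ k)) by rewrite E ray_valK.
    by rewrite tr.
  - exact: (ex_intro2 _ _ z (conj Zz Uz) zE).
have pz : p @ \oo --> z' by exact: subtype_cvg.
have qw : q @ \oo --> w'.
  by apply: subtype_cvg; exact: (cvg_comp _ _ (cvg_comp _ _ φoo noo) zw).
have [[dU0 dUe dUs dUt] _] := dUc.
have pz0 : dU z' (p k) @[k --> \oo] --> (0 : R).
  rewrite -((dUe z' z').2 erefl).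
  exact: (cvg_comp _ _ pz (coarse_metric_continuous dUc (w := z') (x := z'))).
have qw0 : dU w' (q k) @[k --> \oo] --> (0 : R).
  rewrite -((dUe w' w').2 erefl).
  exact: (cvg_comp _ _ qw (coarse_metric_continuous dUc (w := w') (x := w'))).
have S0 : dU z' (p k) + dU (p k) (q k) + dU w' (q k) @[k --> \oo] --> (0 : R).
  by have H := cvgD (cvgD pz0 pq) qw0; rewrite !addr0 in H; exact: H.
have le0 : dU z' w' <= 0.
  apply: (cvgr_to_ge S0); apply: nearW => k.
  rewrite /= (le_trans (dUt (q k) _ _))// (dUs (q k)) lerD2r; exact: dUt.
have zw' : z' = w' by apply/dUe/eqP; rewrite eq_le le0 dU0.
have {}zw' : z = w by exact: (congr1 set_val zw').
have [[_ de _ _] _] := d_coarse.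
by move: r0; rewrite -dwz zw' (de w w).2// ltxx.
Qed.

(** Otherwise some [β n] with [n] arbitrarily large is far from [w] arbitrarily
    late, while its endpoint is close to [w]; the times of the last crossing of
    a small sphere around [w] are those excluded by [no_escape]. *)
Lemma uniform_tail (O : set M) : nbhs w O ->
  exists N S, forall n x, (N <= n)%N -> S <= x -> O (β n (clamp a x)).
Proof.
move=> /d_fine[e1 e10 eO].
have [U [Uo Uw [dU dUc hU]]] := A2 Zw.
have [e2 e20 eU] := d_fine (open_nbhs_nbhs (conj Uo Uw)).
(* Half of e2 makes the closed ball of radius r lie in U. *)
pose r := Num.min e1 (e2 / 2).
have r0 : 0 < r by rewrite lt_min e10 divr_gt0.
have rU x : d w x <= r -> U x.
  move=> xr; apply: eU => /=; apply: (le_lt_trans xr).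
  by rewrite gt_min ltr_pdivrMr// mulr2n mulrDr mulr1 ltrDl e20 orbT.
have [N0 _ HN0] : \forall n \near \oo, d w (z_ n) < r.
  exact: (@zw _ (coarse_metric_near d_coarse w r0)).
apply: contrapT => nNS.
have esc : forall k : nat, exists nt : nat * R, [/\ (k <= nt.1)%N,
    (a <= nt.2 /\ k%:R <= nt.2), d w (z_ nt.1) <= r,
    d w (β nt.1 (clamp a nt.2)) = r &
    forall x, nt.2 < x -> d w (β nt.1 (clamp a x)) <= r].
  move=> k; have [n [x [Nn Sx Ox]]] : exists n x,
      [/\ (maxn k N0 <= n)%N, Num.max a k%:R <= x & ~ O (β n (clamp a x))].
    apply: contrapT => H; apply: nNS; exists (maxn k N0), (Num.max a k%:R).
    move=> n x Nn Sx; apply: contrapT => Ox; apply: H; by exists n, x.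
  move: Nn; rewrite geq_max => /andP[kn N0n].
  move: Sx; rewrite ge_max => /andP[ax kx].
  have zr : d w (z_ n) < r by exact: HN0.
  have hc : continuous (fun x => d w (β n (clamp a x))).
    have [Γβ _ _] := βm n.
    move=> y; apply: (@continuous_comp _ _ _ (β n \o clamp a) (d w)).
      exact: (flow_clamp_continuous Γ_flow).
    exact: coarse_metric_continuous.
  have rx : r <= d w (β n (clamp a x)).
    rewrite leNgt; apply/negP => xr; apply: Ox; apply: eO => /=.
    by apply: (lt_le_trans xr); rewrite ge_min lexx.
  have hoo : \forall x \near +oo, d w (β n (clamp a x)) < r.
    have /limit_at_inftyE bz := βz (n := n).
    have H := cvg_comp _ _ bz (coarse_metric_continuous d_coarse (w := w) (x := z_ n)).
    exact: (cvgr_lt _ H _ zr).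
  have [t [xt tr tx]] := last_crossing hc rx hoo.
  exists (n, t); split=> //=.
  - by split; apply: (le_trans _ xt).
  - exact: ltW.
  - by move=> y /tx/ltW.
have [nt ntP] := choice esc.
apply: (@no_escape U dU r (fun k => (nt k).1) (fun k => (nt k).2)) => //.
- move=> A [N _ NA]; exists N => //= k Nk; apply: NA => /=.
  by have [+ _ _ _ _] := ntP k; apply: leq_trans.
- apply/cvgryPge => b; near=> k.
  have [_ [_ kt] _ _ _] := ntP k.
  by apply: (le_trans _ kt); near: k; exact: nbhs_infty_ger.
- by move=> k; have [_ [] ] := ntP k.
- by move=> k; have [] := ntP k.
- by move=> k; have [] := ntP k.
- by move=> k; have [] := ntP k.
Unshelve. all: by end_near. Qed.

End tails.

(** * Compactness of the moduli space *)

Theorem theorem1 (R : realType) (M : topologicalType) (f G : M -> R)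
    (Z : set M) (ζ : R) (Γ : forall I : set R, set (I -> M)) (E0 a : R)
    (M_metrizable : metrizable R M)
    (f_continuous : continuous f) (G_continuous : continuous G)
    (G_ge0 : forall x, 0 <= G x)
    (Z_zero : Z `<=` G @^-1` [set 0]) (Z_compact : compact Z)
    (f_Z : forall z, Z z -> f z = ζ)
    (Γ_flow : gradient_flow_class f G Γ)
    (E0_ge0 : 0 <= E0) (E0_gap : (E0%:E < spectral_gap f G ζ Z)%E)
    (A1 : conditionA1 G Γ E0 (ray a))
    (A2 : conditionA2 G Γ Z E0 a)
    (γ_ : nat -> ray a -> M)
    (γ_moduli : forall n, moduli G Γ Z E0 (γ_ n)) :
  exists2 φ : nat -> nat, increasing_seq φ &
  exists2 γ : ray a -> M, moduli G Γ Z E0 γ & cvg_C0 (γ_ \o φ) γ.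
Proof.
have [d dc db] := metrizable_metric M_metrizable.
have [φ1 φ1i [γ Γγ γ1]] : exists2 φ : nat -> nat, increasing_seq φ &
    exists2 γ : ray a -> M, Γ (ray a) γ & {compact-open, (γ_ \o φ) @ \oo --> γ}.
  by apply: A1 => n; have [] := γ_moduli n.
have /choice[z1 z1P] : forall n, exists z, Z z /\ limit_at_infty (γ_ (φ1 n)) z.
  by move=> n; have [_ _ [z Zz zl]] := γ_moduli (φ1 n); exists z.
have [φ2 φ2i [w Zw zw]] := compact_subsequence dc db Z_compact (fun n => (z1P n).1).
pose β n := γ_ (φ1 (φ2 n)); pose z_ n := z1 (φ2 n).
have βm n : moduli G Γ Z E0 (β n) by exact: γ_moduli.
have βz n : limit_at_infty (β n) (z_ n) by exact: (z1P _).2.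
have βγ : {compact-open, β @ \oo --> γ}.
  exact: (cvg_comp _ _ (increasing_seq_cvg_infty φ2i) γ1).
have βγp := compact_open_pointwise βγ.
have tail := uniform_tail f_continuous G_continuous G_ge0 f_Z Γ_flow E0_gap A1 A2
  dc db βm βz Γγ βγp zw Zw.
have γc : continuous γ := flow_continuous Γ_flow (closed_interval_ray a) Γγ.
have γw : limit_at_infty γ w.
  apply/limit_at_inftyE => A /db[e e0 eA].
  have e20 : 0 < e / 2 by rewrite divr_gt0.
  have [N [S NS]] := tail _ (coarse_metric_near dc w e20).
  suff : \forall x \near +oo, A (γ (clamp a x)) by [].
  near=> x; apply: eA => /=; apply: (@le_lt_trans _ _ (e / 2)); last by lra.
  have dβ := cvg_comp _ _ (βγp (clamp a x))
    (coarse_metric_continuous dc (w := w) (x := γ (clamp a x))).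
  apply: (cvgr_to_le dβ); near=> n; apply/ltW/NS.
    by near: n; exact: nbhs_infty_ge.
  by near: x; apply: nbhs_pinfty_ge; rewrite num_real.
exists (φ1 \o φ2); first by move=> m n /=; rewrite φ1i -leEnat φ2i.
exists γ.
- split=> //; last by exists w.
  have γl : f (γ (clamp a x)) @[x --> +oo%R] --> ζ.
    rewrite -(f_Z _ Zw); move/limit_at_inftyE : γw => γw.
    by apply: (cvg_comp _ _ γw); exact: f_continuous.
  rewrite (flow_energyE f_continuous G_continuous G_ge0 Γ_flow Γγ γl) lee_fin.
  have /andP[] := limit_height f_continuous G_continuous G_ge0 f_Z Γ_flow βm βγp (clamp a a).
  lra.
- exists (fun n => extension (β n) (z_ n)), (extension γ w); split.
  + move=> n; apply: extensionP => //.
    exact: (flow_continuous Γ_flow (closed_interval_ray a) (let: And3 H _ _ := βm n in H)).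
  + exact: extensionP.
  + exact: compact_open_extension.
Unshelve. all: by end_near. Qed.
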